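(* Let $(X,d,\bar x)$ be a pointed metric space and let $M\subseteq X$ be a closed subset with $\bar x\in M$. Then the following properties are equivalent: (a) there exists a bounded linear extension operator $E:\mathrm{Lip}_0(M)\to\mathrm{Lip}_0(X)$; (b) there exists a Lipschitz map $\hat\delta:X\to\mathrm{Lip}_0(M)^*$ such that $\hat\delta(x)=\delta_x$ for all $x\in M$. In addition, for any $\hat\delta$ as in (b), the corresponding extension operator $E$, given by $E(g)(x)=\langle\hat\delta(x),g\rangle$ for $x\in X$ and $g\in\mathrm{Lip}_0(M)$, satisfies $\|E\|=\|\hat\delta\|$.
   Context: $\mathrm{Lip}_0(X)$ is the Banach space of real-valued Lipschitz functions on $X$ vanishing at $\bar x$, normed by the Lipschitz constant; $\mathrm{Lip}_0(M)$ is defined likewise with base point $\bar x$, and $\mathrm{Lip}_0(M)^*$ is its Banach dual with the dual norm. For $x\in M$, $\delta_x\in\mathrm{Lip}_0(M)^*$ is the evaluation $g\mapsto g(x)$. ''Extension operator'' means $E(g)|_M=g$ for all $g\in\mathrm{Lip}_0(M)$. $\|E\|$ is the operator norm and $\|\hat\delta\|$ is the Lipschitz constant of $\hat\delta$. *)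

(* Defs.v *)
From HB Require Import structures.
From mathcomp Require Import all_boot all_order all_algebra.
From mathcomp Require Import all_classical all_reals all_analysis.

Set Implicit Arguments.
Unset Strict Implicit.
Unset Printing Implicit Defensive.

Import Order.TTheory GRing.Theory Num.Theory.
Import numFieldNormedType.Exports.

Local Open Scope classical_set_scope.
Local Open Scope ring_scope.

Section subspace_metric.
Context {R : realType} {X : metricType R} (M : set X).
Implicit Types x y : set_type M.

Let dist x y : R := mdist (set_val x) (set_val y).

Let dist_ge0 x y : 0 <= dist x y.
Proof. exact: mdist_ge0. Qed.

Let dist_positivity x y : dist x y = 0 -> x = y.
Proof. by move=> /mdist_positivity /val_inj. Qed.

Let ballE x d : ball x d = [set y | dist x y < d].
Proof.
have -> : ball x d = set_val @^-1` ball (set_val x) d by [].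
by rewrite ballEmdist.
Qed.

HB.instance Definition _ :=
  @PseudoMetric_isMetric.Build R (set_type M) dist dist_ge0 dist_positivity
    ballE.

End subspace_metric.

Lemma mdist_set_val {R : realType} {X : metricType R} (M : set X) (x y : M) :
  mdist x y = mdist (set_val x) (set_val y).
Proof. by []. Qed.

Lemma sup_nneg {R : realType} (A : set R) :
  (forall r, A r -> 0 <= r) -> 0 <= sup A.
Proof.
move=> A0; have [[[r Ar] ubA]|nsA] := pselect (has_sup A).
  by apply: le_trans (A0 _ Ar) _; exact: ub_le_sup.
by rewrite sup_out.
Qed.

Section lipschitz.
Context {R : realType} {T : metricType R} {V : normedModType R}.
Implicit Types f g : T -> V.

(* The library's [lipschitz] needs a normed module as domain. *)
Definition lipschitz_map f :=
  exists K : R, forall x y, `|f x - f y| <= K * mdist x y.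

Definition lip_quotients f : set R :=
  [set q | exists x y, x != y /\ q = `|f x - f y| / mdist x y].

(* [sup] is [0] on the empty set, which is the intended value when [T] has a
   single point; on non-Lipschitz maps the value is irrelevant. *)
Definition lip_const f : R := sup (lip_quotients f).

Lemma lip_quotients_ubound f K :
  (forall x y, `|f x - f y| <= K * mdist x y) -> ubound (lip_quotients f) K.
Proof.
move=> fK _ [x [y [xy ->]]].
by rewrite ler_pdivrMr ?mdist_gt0.
Qed.

Lemma lip_const_ge0 f : 0 <= lip_const f.
Proof. by apply: sup_nneg => _ [x [y [_ ->]]]; rewrite divr_ge0 ?mdist_ge0. Qed.

Lemma lip_constP f : lipschitz_map f ->
  forall x y, `|f x - f y| <= lip_const f * mdist x y.
Proof.
move=> [K fK] x y; have [->|xy] := eqVneq x y.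
  by rewrite subrr normr0 mulr_ge0 ?mdist_ge0 ?lip_const_ge0.
rewrite -ler_pdivrMr ?mdist_gt0//; apply: ub_le_sup; last by exists x, y.
by exists K; exact: lip_quotients_ubound.
Qed.

Lemma lip_const_le f K : 0 <= K ->
  (forall x y, `|f x - f y| <= K * mdist x y) -> lip_const f <= K.
Proof.
move=> K0 fK; rewrite /lip_const; have [->|/set0P q0] := eqVneq (lip_quotients f) set0.
  by rewrite sup0.
by apply: ge_sup => //; exact: lip_quotients_ubound.
Qed.

Lemma lipschitz_map0 : lipschitz_map (fun _ : T => 0 : V).
Proof. by exists 0 => x y; rewrite subrr normr0 mul0r. Qed.

Lemma lipschitz_mapD f g : lipschitz_map f -> lipschitz_map g ->
  lipschitz_map (f \+ g).
Proof.
move=> [K fK] [L gL]; exists (K + L) => x y /=.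
by rewrite opprD addrACA mulrDl (le_trans (ler_normD _ _)) ?lerD.
Qed.

Lemma lipschitz_mapZ (a : R) f : lipschitz_map f -> lipschitz_map (a \*: f).
Proof.
move=> [K fK]; exists (`|a| * K) => x y /=.
by rewrite -scalerBr normrZ -mulrA ler_wpM2l.
Qed.

Lemma lip_constD f g : lipschitz_map f -> lipschitz_map g ->
  lip_const (f \+ g) <= lip_const f + lip_const g.
Proof.
move=> lf lg; apply: lip_const_le; first by rewrite addr_ge0 ?lip_const_ge0.
move=> x y /=; rewrite opprD addrACA mulrDl (le_trans (ler_normD _ _))//.
by rewrite lerD ?lip_constP.
Qed.

Lemma lip_constZ_le (a : R) f : lipschitz_map f ->
  lip_const (a \*: f) <= `|a| * lip_const f.
Proof.
move=> lf; apply: lip_const_le; first by rewrite mulr_ge0 ?lip_const_ge0.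
by move=> x y /=; rewrite -scalerBr normrZ -mulrA ler_wpM2l ?lip_constP.
Qed.

Lemma lip_constZ (a : R) f : lipschitz_map f ->
  lip_const (a \*: f) = `|a| * lip_const f.
Proof.
move=> lf; apply/eqP; rewrite eq_le lip_constZ_le//=.
have [->|a0] := eqVneq a 0; first by rewrite normr0 mul0r lip_const_ge0.
rewrite -ler_pdivlMl ?normr_gt0// -normfV.
apply: le_trans (lip_constZ_le a^-1 (lipschitz_mapZ a lf)).
rewrite le_eqVlt (_ : a^-1 \*: (a \*: f) = f) ?eqxx//.
by apply/funext => x /=; rewrite scalerA mulVf// scale1r.
Qed.

End lipschitz.

Section lip0.
Context {R : realType} {T : metricType R} (x0 : T).

Definition lip0_pred : {pred T -> R^o} :=
  [pred f : T -> R^o | `[< lipschitz_map f /\ f x0 = 0 >]].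

Lemma lip0_submod_closed : submod_closed lip0_pred.
Proof.
split; first by apply/asboolP; split=> //; exact: lipschitz_map0.
move=> a f g /asboolP[lf f0] /asboolP[lg g0]; apply/asboolP; split.
  exact: lipschitz_mapD (lipschitz_mapZ a lf) lg.
by rewrite -[LHS]/(a *: f x0 + g x0) f0 g0 scaler0 addr0.
Qed.

HB.instance Definition _ :=
  GRing.isSubmodClosed.Build R (T -> R^o) lip0_pred lip0_submod_closed.

Record Lip0 := MkLip0 { lip0_fun :> T -> R^o ; _ : lip0_fun \in lip0_pred }.

HB.instance Definition _ := [isSub for lip0_fun].
HB.instance Definition _ := [Choice of Lip0 by <:].
HB.instance Definition _ := [SubChoice_isSubLmodule of Lip0 by <:].

Lemma lip0_lipschitz (f : Lip0) : lipschitz_map f.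
Proof. by case: f => f /= /asboolP[]. Qed.

Lemma lip0_base (f : Lip0) : f x0 = 0.
Proof. by case: f => f /= /asboolP[]. Qed.

Lemma lip0P (f g : Lip0) : f =1 g -> f = g.
Proof. by move=> fg; apply: val_inj; apply/funext. Qed.

Let norm (f : Lip0) : R := lip_const f.

Let normD f g : norm (f + g) <= norm f + norm g.
Proof. by apply: lip_constD; exact: lip0_lipschitz. Qed.

Let normZ a f : norm (a *: f) = `|a| * norm f.
Proof. by apply: lip_constZ; exact: lip0_lipschitz. Qed.

Let norm_eq0 f : norm f = 0 -> f = 0.
Proof.
move=> f0; apply: lip0P => x /=.
have := lip_constP (lip0_lipschitz f) x x0.
rewrite -/(norm f) f0 mul0r lip0_base subr0 normr_le0 => /eqP ->.
by [].
Qed.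

HB.instance Definition _ :=
  Lmodule_isNormed.Build R Lip0 normD normZ norm_eq0.

Lemma lip0_normE (f : Lip0) : `|f| = lip_const f.
Proof. by []. Qed.

End lip0.

Section operator_norm.
Context {R : realType} {V W : normedModType R}.

Definition op_norm (f : V -> W) : R :=
  sup [set r | exists2 v : V, `|v| <= 1 & r = `|f v|].

Lemma op_norm_has_sup (f : V -> W) : bounded_fun_norm f ->
  has_sup [set r | exists2 v : V, `|v| <= 1 & r = `|f v|].
Proof.
move=> bf; split; first by exists `|f 0|, 0; rewrite ?normr0.
by have [C fC] := bf 1; exists C => _ [v v1 ->]; exact: fC.
Qed.

Lemma op_norm_ge0 (f : V -> W) : 0 <= op_norm f.
Proof. by apply: sup_nneg => _ [v _ ->]. Qed.

Lemma op_normP (f : V -> W) : linear f -> bounded_fun_norm f ->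
  forall v, `|f v| <= op_norm f * `|v|.
Proof.
move=> lf bf v.
have f0 : f 0 = 0.
  by have := lf (-1) 0 0; rewrite scaleN1r addNr scaleN1r addNr.
have fZ a u : f (a *: u) = a *: f u.
  by have := lf a u 0; rewrite addr0 f0 addr0.
have [->|v0] := eqVneq v 0; first by rewrite f0 !normr0 mulr0.
have nv : 0 < `|v| by rewrite normr_gt0.
rewrite -ler_pdivrMr// mulrC -[X in X * _]ger0_norm ?invr_ge0//.
rewrite -normrZ -fZ.
apply: ub_le_sup; first by have [] := op_norm_has_sup bf.
by exists (`|v|^-1 *: v) => //; rewrite normfZV.
Qed.

Lemma op_norm_le (f : V -> W) C : 0 <= C ->
  (forall v, `|f v| <= C * `|v|) -> op_norm f <= C.
Proof.
move=> C0 fC; apply: ge_sup; first by exists `|f 0|, 0; rewrite ?normr0.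
by move=> _ [v v1 ->]; rewrite (le_trans (fC v))// ler_piMr.
Qed.

Lemma bounded_fun_normP (f : V -> W) C :
  (forall v, `|f v| <= C * `|v|) -> bounded_fun_norm f.
Proof.
move=> fC r; exists (`|C| * r) => v vr.
by rewrite (le_trans (fC v))// (le_trans (ler_norm _))// normrM normr_id ler_wpM2l.
Qed.

End operator_norm.

Section topdual.
Context {R : realType} (V : normedModType R).

Definition topdual_pred : {pred V -> R^o} :=
  [pred f : V -> R^o | `[< linear f /\ bounded_fun_norm f >]].

Lemma topdual_submod_closed : submod_closed topdual_pred.
Proof.
split.
  apply/asboolP; split; first by move=> a u v; rewrite scaler0 addr0.
  by move=> r; exists 0 => v _; rewrite normr0.
move=> a f g /asboolP[lf bf] /asboolP[lg bg]; apply/asboolP; split.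
  move=> b u v; rewrite -![(a *: f + g) _]/(a *: f _ + g _).
  by rewrite lf lg !scalerDr !scalerA (mulrC a b) addrACA.
move=> r; have [C fC] := bf r; have [D gD] := bg r.
exists (`|a| * C + D) => v vr; rewrite -[(a *: f + g) v]/(a *: f v + g v).
by rewrite (le_trans (ler_normD _ _))// lerD ?gD// normrZ ler_wpM2l ?fC.
Qed.

HB.instance Definition _ :=
  GRing.isSubmodClosed.Build R (V -> R^o) topdual_pred topdual_submod_closed.

Record topdual := MkTopdual { topdual_fun :> V -> R^o ; _ : topdual_fun \in topdual_pred }.

HB.instance Definition _ := [isSub for topdual_fun].
HB.instance Definition _ := [Choice of topdual by <:].
HB.instance Definition _ := [SubChoice_isSubLmodule of topdual by <:].

Lemma topdual_linear (f : topdual) : linear f.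
Proof. by case: f => f /= /asboolP[]. Qed.

HB.instance Definition _ (f : topdual) :=
  GRing.isLinear.Build R V R^o _ (topdual_fun f) (topdual_linear f).

Lemma topdual_bounded (f : topdual) : bounded_fun_norm f.
Proof. by case: f => f /= /asboolP[]. Qed.

Lemma topdualP (f g : topdual) : f =1 g -> f = g.
Proof. by move=> fg; apply: val_inj; apply/funext. Qed.

Let norm (f : topdual) : R := op_norm f.

Let norm_bound (f : topdual) v : `|f v| <= norm f * `|v|.
Proof. by apply: op_normP; [exact: topdual_linear|exact: topdual_bounded]. Qed.

Let normD f g : norm (f + g) <= norm f + norm g.
Proof.
apply: op_norm_le => [|v]; first by rewrite addr_ge0 ?op_norm_ge0.
by rewrite mulrDl (le_trans (ler_normD _ _))// lerD ?norm_bound.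
Qed.

Let normZ_le a f : norm (a *: f) <= `|a| * norm f.
Proof.
apply: op_norm_le => [|v]; first by rewrite mulr_ge0 ?op_norm_ge0.
by rewrite -[(a *: f) v]/(a *: f v) normrZ -mulrA ler_wpM2l ?norm_bound.
Qed.

Let normZ a f : norm (a *: f) = `|a| * norm f.
Proof.
apply/eqP; rewrite eq_le normZ_le/=.
have [->|a0] := eqVneq a 0; first by rewrite normr0 mul0r op_norm_ge0.
rewrite -ler_pdivlMl ?normr_gt0// -normfV.
apply: le_trans (normZ_le a^-1 (a *: f)).
by rewrite scalerA mulVf// scale1r.
Qed.

Let norm_eq0 f : norm f = 0 -> f = 0.
Proof.
move=> f0; apply: topdualP => v.
by have := norm_bound f v; rewrite f0 mul0r normr_le0 => /eqP ->.
Qed.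

HB.instance Definition _ :=
  Lmodule_isNormed.Build R topdual normD normZ norm_eq0.

Lemma topdual_normE (f : topdual) : `|f| = op_norm f.
Proof. by []. Qed.

End topdual.

Section evaluation.
Context {R : realType} {T : metricType R} (x0 : T).

Lemma eval_topdual (x : T) : (fun g : Lip0 x0 => g x) \in @topdual_pred R (Lip0 x0).
Proof.
apply/asboolP; split=> [a f g|] //.
apply: (bounded_fun_normP (C := mdist x x0)) => g.
have := lip_constP (lip0_lipschitz g) x x0.
by rewrite lip0_base subr0 mulrC.
Qed.

Definition delta (x : T) : topdual (Lip0 x0) := MkTopdual (eval_topdual x).

End evaluation.

Definition sub_base {R : realType} {X : metricType R} {M : set X} {xbar : X}
  (hM : M xbar) : set_type M := exist _ xbar (mem_set hM).

Section extension.
Context {R : realType} {X : metricType R} {M : set X} {xbar : X}.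
Variable hM : M xbar.

Definition extension_operator (E : Lip0 (sub_base hM) -> Lip0 xbar) :=
  forall (g : Lip0 (sub_base hM)) (x : set_type M), E g (set_val x) = g x.

Definition extends_delta (dh : X -> topdual (Lip0 (sub_base hM))) :=
  forall x : set_type M, dh (set_val x) = delta (sub_base hM) x.

End extension.

(* Main.v *)
Require Import Defs.
From HB Require Import structures.
From mathcomp Require Import all_boot all_order all_algebra.
From mathcomp Require Import all_classical all_reals all_analysis.
Import Order.TTheory GRing.Theory Num.Theory.
Import numFieldNormedType.Exports.

Local Open Scope classical_set_scope.
Local Open Scope ring_scope.

(** For any normed space [V], bounded linear maps [E : V -> Lip_0(X)] correspond
    to Lipschitz maps [dh : X -> V^*] with [dh xbar = 0] through
    [E v x = dh x v]. Both [op_norm E] and [lip_const dh] are the least [C] with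
    [`|dh x v - dh y v| <= C * `|v| * mdist x y], so they agree. For
    [V = Lip_0(M)], [E] extends functions iff [dh] extends [delta], and
    [delta] vanishes at the base point. *)

Lemma topdual_norm_bound (R : realType) (V : normedModType R) (f : topdual V) v :
  `|f v| <= `|f| * `|v|.
Proof. exact: op_normP (topdual_linear f) (topdual_bounded f) v. Qed.

Lemma lip0_norm_bound (R : realType) (X : metricType R) (xbar : X)
    (f : Lip0 xbar) x y :
  `|f x - f y| <= `|f| * mdist x y.
Proof. exact: lip_constP (lip0_lipschitz f) x y. Qed.

Lemma delta_base (R : realType) (T : metricType R) (x0 : T) : delta x0 x0 = 0.
Proof. by apply: topdualP => g; exact: lip0_base. Qed.

Section transpose_of_dual_valued_map.
Context {R : realType} {X : metricType R} {V : normedModType R}.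
Variables (xbar : X) (dh : X -> topdual V).
Hypotheses (dh_lip : lipschitz_map dh) (dh_base : dh xbar = 0).

(** The dual norm bound is applied to the functional [dh x - dh y]. For fixed [v] this makes
    [x |-> dh x v] Lipschitz; tracking [v] in the constant bounds the operator norm of the
    transpose. *)
Lemma dual_valued_bound v x y :
  `|dh x v - dh y v| <= lip_const dh * `|v| * mdist x y.
Proof.
rewrite -[dh x v - dh y v]/((dh x - dh y) v).
rewrite (le_trans (topdual_norm_bound _ _ _ _))// mulrAC ler_wpM2r//.
exact: lip_constP.
Qed.

Lemma transpose_subproof v : (fun x => dh x v) \in @lip0_pred R X xbar.
Proof.
apply/asboolP; split; last by rewrite dh_base.
by exists (lip_const dh * `|v|); exact: dual_valued_bound.
Qed.

Definition transpose v : Lip0 xbar := MkLip0 (transpose_subproof v).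

Lemma transpose_linear : linear transpose.
Proof. by move=> a u v; apply: lip0P => x; exact: topdual_linear. Qed.

HB.instance Definition _ :=
  GRing.isLinear.Build R V (Lip0 xbar) _ transpose transpose_linear.

Lemma transpose_norm_le v : `|transpose v| <= lip_const dh * `|v|.
Proof.
apply: lip_const_le; last exact: dual_valued_bound.
by rewrite mulr_ge0 ?lip_const_ge0.
Qed.

Lemma transpose_bounded : bounded_fun_norm transpose.
Proof. exact: bounded_fun_normP transpose_norm_le. Qed.

End transpose_of_dual_valued_map.

Section evaluation_along_operator.
Context {R : realType} {X : metricType R} {V : normedModType R} {xbar : X}.
Variables (E : V -> Lip0 xbar).
Hypotheses (E_lin : linear E) (E_bnd : bounded_fun_norm E).

(** Mirror image of [dual_valued_bound]: the factor [|v|] comes last because [x] and [y] are now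
    fixed and the functional [v |-> E v x - E v y] is estimated. *)
Lemma operator_value_bound v x y :
  `|E v x - E v y| <= op_norm E * mdist x y * `|v|.
Proof.
rewrite (le_trans (lip0_norm_bound _ _ _ _ _ _))// mulrAC ler_wpM2r ?mdist_ge0//.
exact: op_normP.
Qed.

Lemma eval_along_subproof x : (fun v => E v x) \in @topdual_pred R V.
Proof.
apply/asboolP; split; first by move=> a u v; rewrite E_lin.
apply: (bounded_fun_normP (C := op_norm E * mdist x xbar)) => v.
(* Since [E v] vanishes at [xbar], the bound on differences becomes a bound on the value at [x]. *)
by have := operator_value_bound v x xbar; rewrite lip0_base subr0.
Qed.

Definition eval_along x : topdual V := MkTopdual (eval_along_subproof x).

Lemma eval_along_le x y :
  `|eval_along x - eval_along y| <= op_norm E * mdist x y.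
Proof.
apply: op_norm_le => [|v]; first by rewrite mulr_ge0 ?op_norm_ge0 ?mdist_ge0.
exact: operator_value_bound.
Qed.

Lemma eval_along_lipschitz : lipschitz_map eval_along.
Proof. by exists (op_norm E); exact: eval_along_le. Qed.

End evaluation_along_operator.

(** Neither construction increases the constant, and evaluating along the transpose gives back [dh];
    hence both inequalities. *)
Lemma op_norm_transpose (R : realType) (X : metricType R) (V : normedModType R)
    (xbar : X) (dh : X -> topdual V) (dh_lip : lipschitz_map dh)
    (dh_base : dh xbar = 0) :
  op_norm (transpose xbar dh dh_lip dh_base) = lip_const dh.
Proof.
set E := transpose _ _ _ _.
have E_lin : linear E by exact: transpose_linear.
have E_bnd : bounded_fun_norm E by exact: transpose_bounded.
apply/eqP; rewrite eq_le; apply/andP; split.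
  by apply: op_norm_le; [exact: lip_const_ge0|exact: transpose_norm_le].
have dhE : dh = eval_along E E_lin E_bnd.
  by apply/funext => x; apply: topdualP.
apply: lip_const_le; first exact: op_norm_ge0.
by rewrite dhE; exact: eval_along_le.
Qed.

Theorem proposition2p16 (R : realType) (X : metricType R) (xbar : X)
    (M : set X) (hcl : closed M) (hM : M xbar) :
  ((exists E : {linear Lip0 (sub_base hM) -> Lip0 xbar},
      bounded_fun_norm E /\ extension_operator E)
   <->
   (exists dh : X -> topdual (Lip0 (sub_base hM)),
      lipschitz_map dh /\ extends_delta dh))
  /\
  (forall dh : X -> topdual (Lip0 (sub_base hM)),
     lipschitz_map dh -> extends_delta dh ->
     exists E : {linear Lip0 (sub_base hM) -> Lip0 xbar},
       [/\ forall (g : Lip0 (sub_base hM)) (x : X), E g x = dh x g,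
           bounded_fun_norm E,
           extension_operator E
         & op_norm E = lip_const dh]).
Proof.
(* This is the second claim; forgetting the norm equality, it also yields (b) implies (a). *)
have opE (dh : X -> topdual (Lip0 (sub_base hM))) :
    lipschitz_map dh -> extends_delta dh ->
    exists E : {linear Lip0 (sub_base hM) -> Lip0 xbar},
      [/\ forall (g : Lip0 (sub_base hM)) (x : X), E g x = dh x g,
          bounded_fun_norm E, extension_operator E & op_norm E = lip_const dh].
  move=> dh_lip dh_ext.
  (* The base point lies in [M], so the value of [dh] there is prescribed. *)
  have dh_base : dh xbar = 0 by rewrite (dh_ext (sub_base hM)) delta_base.
  exists (transpose xbar dh dh_lip dh_base); split=> [//|||].
  - exact: transpose_bounded.
  - by move=> g x; rewrite /= dh_ext.
  - exact: op_norm_transpose.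
split=> //; split=> [[E [E_bnd E_ext]]|[dh [dh_lip dh_ext]]]; last first.
  by have [E [_ E_bnd E_ext _]] := opE dh dh_lip dh_ext; exists E.
have E_lin : linear E by exact: linearP.
exists (eval_along E E_lin E_bnd); split; first exact: eval_along_lipschitz.
(* Tested on each [g], the equality of functionals is the extension property of [E]. *)
by move=> x; apply: topdualP => g; exact: E_ext.
Qed.
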